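(* Let $a,b$ be distinct relatively prime positive integers and let $\mathcal{U}=\mathcal{U}(a,b)$. Then: (i) for any integer $c>(b+1)a$, if $\{c,c+a,c+2a,\dots,c+ba\}\subset\mathcal{U}$, then $c+(b+1)a\notin\mathcal{U}$; (ii) for any integer $c>b(a+1)$, if $\{c,c+b,c+2b,\dots,c+ab\}\subset\mathcal{U}$, then $c+(a+1)b\notin\mathcal{U}$.
   Context: For distinct positive integers $a,b$, the Ulam sequence $\mathcal{U}(a,b)$ is the increasing sequence whose first two terms are $a$ and $b$ and in which each subsequent term is the smallest integer larger than all previous terms that can be written as the sum of two distinct earlier terms in exactly one way (unordered pairs). We identify the sequence with its set of terms. *)

(* Defs.v *)
From mathcomp Require Import all_boot.

Set Implicit Arguments.
Unset Strict Implicit.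
Unset Printing Implicit Defensive.

(* The number of unordered pairs {x, y} of distinct terms of s with x + y = m,
   for a duplicate-free s; each pair is counted once, as (x, y) with x < y. *)
Definition nreps (s : seq nat) (m : nat) : nat :=
  count (fun p => (p.1 < p.2) && (p.1 + p.2 == m)) [seq (x, y) | x <- s, y <- s].

Definition ulam_candidate (s : seq nat) : pred nat :=
  fun m => all (fun x => x < m) s && (nreps s m == 1).

(* A sum of two distinct terms of s is at most sumn s, so the search misses no
   candidate; [find] returns an index in iota 0 _, which is the number itself. *)
Definition ulam_next (s : seq nat) : nat :=
  find (ulam_candidate s) (iota 0 (sumn s).+1).

(* The first n.+2 terms of U(a, b), in increasing order; neither a < b nor
   b < a is assumed. *)
Definition ulam_prefix (a b n : nat) : seq nat :=
  iter n (fun s => rcons s (ulam_next s)) [:: minn a b; maxn a b].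

Definition ulam (a b m : nat) : Prop := exists n, m \in ulam_prefix a b n.

(* The remaining lemmas show that, for distinct positive a and b, the prefixes
   are strictly increasing and [ulam_next] returns their least candidate. *)
Lemma nreps_last_two (t : seq nat) (x y : nat) :
  sorted ltn (rcons (rcons t x) y) -> nreps (rcons (rcons t x) y) (x + y) = 1.
Proof.
set s := rcons _ y => srt.
have us : uniq s by apply: sorted_uniq srt; [exact: ltn_trans | exact: ltnn].
have := srt; rewrite (sorted_pairwise ltn_trans) /s !pairwise_rcons !all_rcons.
case/andP=> /andP[/= ltxy /allP lty] /andP[/allP ltx _].
have xs : x \in s by rewrite mem_rcons inE mem_rcons inE eqxx orbT.
have ys : y \in s by rewrite mem_rcons inE eqxx.
rewrite /nreps -size_filter -[RHS]/(size [:: (x, y)]).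
apply/perm_size/uniq_perm => //.
  by rewrite filter_uniq // allpairs_uniq // => -[? ?] [? ?].
move=> [u v]; rewrite mem_filter inE /=.
apply/idP/eqP => [|[-> ->]]; last first.
  by rewrite ltxy eqxx /=; apply/allpairsP; exists (x, y).
case/andP=> /andP[ltuv /eqP euv] /allpairsP[[u' v'] /= [us' vs' [eu ev]]].
subst u' v'; have le_y w : w \in s -> w = y \/ w <= x.
  rewrite mem_rcons inE mem_rcons inE => /or3P[/eqP->|/eqP->|wt]; [by left|by right|].
  by right; apply/ltnW/ltx.
have [vy|vx] := le_y v vs'.
  by move: euv; rewrite vy => /addIn ->.
have ux : u < x by apply: leq_trans ltuv vx.
have : u + v < x + y by rewrite -addSn leq_add // (leq_trans vx) // ltnW.
by rewrite euv ltnn.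
Qed.

Lemma nreps_le_sumn (s : seq nat) (m : nat) : 0 < nreps s m -> m <= sumn s.
Proof.
rewrite /nreps -has_count => /hasP[[x y] /allpairsP[[x' y'] /= [xs ys [-> ->]]]].
case/andP=> ltxy /eqP <-.
move: xs ys; elim: s => [//|z s IHs] /=; rewrite !inE.
have le_sum w : w \in s -> w <= sumn s.
  by elim: {IHs} s => //= u s IHs; rewrite inE => /orP[/eqP->|/IHs wl];
    [exact: leq_addr | apply: leq_trans wl (leq_addl _ _)].
case/orP=> [/eqP xz|xs]; case/orP=> [/eqP yz|ys].
- by move: ltxy; rewrite xz yz ltnn.
- by rewrite xz leq_add2l le_sum.
- by rewrite yz addnC leq_add2l le_sum.
- exact: leq_trans (IHs xs ys) (leq_addl _ _).
Qed.

Lemma ulam_nextP (s : seq nat) :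
  all (ltn 0) s -> sorted ltn s -> 1 < size s ->
  ulam_candidate s (ulam_next s) /\
  (forall m, ulam_candidate s m -> ulam_next s <= m).
Proof.
have bnd m : ulam_candidate s m -> m < (sumn s).+1.
  by case/andP=> _ /eqP e1; rewrite ltnS nreps_le_sumn // e1.
move=> pos srt sz.
have [m0 cm0] : exists m, ulam_candidate s m.
  move: pos srt sz; case/lastP: s {bnd} => // s y; case/lastP: s => // t x.
  rewrite !all_rcons => /and3P[/= y0 x0 _] srt _.
  have := srt; rewrite (sorted_pairwise ltn_trans) !pairwise_rcons !all_rcons.
  case/andP=> /andP[/= ltxy /allP lty] _.
  exists (x + y); rewrite /ulam_candidate nreps_last_two // eqxx andbT.
  rewrite !all_rcons -{1}[y]add0n ltn_add2r x0 -{1}[x]addn0 ltn_add2l y0 /=.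
  by apply/allP => w /lty /= ltwy; apply: ltn_addl.
have hs : has (ulam_candidate s) (iota 0 (sumn s).+1).
  by apply/hasP; exists m0; rewrite // mem_iota add0n bnd.
split=> [|m cm].
  have := nth_find 0 hs; rewrite nth_iota //.
  by move: hs; rewrite has_find size_iota.
rewrite leqNgt; apply/negP => ltm.
by have := before_find 0 ltm; rewrite nth_iota ?add0n ?cm // bnd.
Qed.

Lemma ulam_prefixP (a b n : nat) : 0 < a -> 0 < b -> a != b ->
  [/\ all (ltn 0) (ulam_prefix a b n), sorted ltn (ulam_prefix a b n)
    & size (ulam_prefix a b n) = n.+2].
Proof.
move=> a0 b0 nab; elim: n => [|n [pos srt sz]].
  split=> //=; rewrite !andbT.
    by rewrite leq_min leq_max a0 b0.
  by move: nab; rewrite neq_ltn /minn /maxn; case: (ltngtP a b).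
have sz2 : 1 < size (ulam_prefix a b n) by rewrite sz.
have [/andP[/allP lts _] _] := ulam_nextP pos srt sz2.
have -> : ulam_prefix a b n.+1
        = rcons (ulam_prefix a b n) (ulam_next (ulam_prefix a b n)) by [].
have next0 : 0 < ulam_next (ulam_prefix a b n).
  have /hasP[x xs _] : has predT (ulam_prefix a b n) by rewrite has_predT ltnW.
  exact: leq_ltn_trans (leq0n x) (lts x xs).
split; last by rewrite size_rcons sz.
  by rewrite all_rcons pos andbT.
rewrite (sorted_pairwise ltn_trans) pairwise_rcons -(sorted_pairwise ltn_trans).
by rewrite srt andbT; apply/allP.
Qed.

(* Main.v *)
Require Import Defs.
From mathcomp Require Import all_boot zify.

Set Implicit Arguments.
Unset Strict Implicit.
Unset Printing Implicit Defensive.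

(** The number (b + 1) a is itself a term of U(a, b).  Hence, for c > (b + 1) a,
    if c and c + b a are terms then c + (b + 1) a has the two representations
    c + (b + 1) a and (c + b a) + a, so it is not a term; part (ii) follows by
    exchanging a and b.

    To see that (b + 1) a = a + a b is a term when a, b > 1, one shows that
    a + j b is a term for all j <= a: every term is a combination p a + q b with
    p, q >= 0, coprimality leaves very few such combinations of this value, and
    a proper multiple i a with 2 <= i <= b is never a term, so that
    b + (a + (j - 1) b) is the only representation. *)

(** * Counting representations, and growth of the prefixes *)

Lemma nreps_eq1P (s : seq nat) (m : nat) : uniq s ->
  nreps s m = 1 <->
  exists x y, [/\ x \in s, y \in s, x < y, x + y = m
    & forall u v, u \in s -> v \in s -> u < v -> u + v = m -> u = x].
Proof.
move=> us; rewrite /nreps -size_filter; set P := fun p : nat * nat => _.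
set ps := [seq p <- _ | P p].
have ups : uniq ps by rewrite filter_uniq // allpairs_uniq // => -[? ?] [? ?].
have psP u v : reflect [/\ u \in s, v \in s, u < v & u + v = m] ((u, v) \in ps).
  rewrite mem_filter /P /=; apply: (iffP andP).
    by case=> /andP[-> /eqP->] /allpairsP[[? ?] /= [? ? [-> ->]]].
  case=> us' vs -> ->; rewrite eqxx; split=> //.
  by apply/allpairsP; exists (u, v).
split=> [|[x [y [xs ys ltxy exy uniq_xy]]]].
  case e: ps => [|[x y] [|//]] // _.
  have /psP[xs ys ltxy exy] : (x, y) \in ps by rewrite e inE.
  exists x, y; split=> // u v us' vs ltuv euv.
  have : (u, v) \in ps by apply/psP.
  by rewrite e inE => /eqP[].
rewrite -[RHS]/(size [:: (x, y)]); apply/perm_size/uniq_perm => // -[u v].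
rewrite inE; apply/psP/eqP => [[us' vs ltuv euv]|[-> ->] //].
have eux := uniq_xy u v us' vs ltuv euv.
by congr (_, _); lia.
Qed.

Lemma ulamC (a b m : nat) : ulam a b m -> ulam b a m.
Proof. by case=> n; exists n; rewrite /ulam_prefix minnC maxnC. Qed.

Lemma mem_ulam_prefix0 (a b m : nat) :
  (m \in ulam_prefix a b 0) = (m == a) || (m == b).
Proof. by rewrite !inE; apply/idP/idP; lia. Qed.

Lemma ulam_l (a b : nat) : ulam a b a.
Proof. by exists 0; rewrite mem_ulam_prefix0 eqxx. Qed.

Lemma ulam_r (a b : nat) : ulam a b b.
Proof. by exists 0; rewrite mem_ulam_prefix0 eqxx orbT. Qed.

Lemma mem_ulam_prefixS (a b n m : nat) :
  (m \in ulam_prefix a b n.+1)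
  = (m == ulam_next (ulam_prefix a b n)) || (m \in ulam_prefix a b n).
Proof. by rewrite mem_rcons inE. Qed.

Lemma sub_ulam_prefix (a b n d m : nat) :
  m \in ulam_prefix a b n -> m \in ulam_prefix a b (d + n).
Proof. by elim: d => // d IHd /IHd; rewrite addSn mem_ulam_prefixS orbC => ->. Qed.

(** * Terms of the whole sequence and their unique representations *)

Section Terms.
Context (a b : nat) (a0 : 0 < a) (b0 : 0 < b) (nab : a != b).

Lemma ulam_prefix_uniq n : uniq (ulam_prefix a b n).
Proof.
have [_ srt _] := ulam_prefixP n a0 b0 nab.
by apply: sorted_uniq srt; [exact: ltn_trans | exact: ltnn].
Qed.

Lemma ulam_prefix_nextP n :
  ulam_candidate (ulam_prefix a b n) (ulam_next (ulam_prefix a b n)) /\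
  forall m, ulam_candidate (ulam_prefix a b n) m ->
    ulam_next (ulam_prefix a b n) <= m.
Proof.
by have [pos srt sz] := ulam_prefixP n a0 b0 nab; apply: ulam_nextP; rewrite ?sz.
Qed.

Lemma ulam_prefix_lt_next n m :
  m \in ulam_prefix a b n -> m < ulam_next (ulam_prefix a b n).
Proof. by have [/andP[/allP lt_next _] _] := ulam_prefix_nextP n => /lt_next. Qed.

(** Each extension appends a number above all present terms, so a term that enters after a prefix
    exceeds everything in that prefix. *)
Lemma ulam_prefix_initial n x y :
  ulam a b x -> y \in ulam_prefix a b n -> x <= y -> x \in ulam_prefix a b n.
Proof.
case=> k xk yn lexy; have {xk} := sub_ulam_prefix n xk.
rewrite addnC; elim: k => // k IHk.
rewrite addSn mem_ulam_prefixS => /orP[/eqP ex|/IHk //].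
have /ulam_prefix_lt_next : y \in ulam_prefix a b (k + n).
  exact: sub_ulam_prefix.
by rewrite -ex ltnNge lexy.
Qed.

Lemma ulam_prefix_next_initial n x :
  ulam a b x -> x < ulam_next (ulam_prefix a b n) -> x \in ulam_prefix a b n.
Proof.
move=> ux ltx; have : x \in ulam_prefix a b n.+1.
  apply: ulam_prefix_initial ux _ (ltnW ltx).
  by rewrite mem_ulam_prefixS eqxx.
by rewrite mem_ulam_prefixS ltn_eqF.
Qed.

Lemma ulam_gt0 m : ulam a b m -> 0 < m.
Proof. by case=> n; have [/allP pos _ _] := ulam_prefixP n a0 b0 nab => /pos. Qed.

(** Uniqueness passes from a prefix to the whole sequence: terms are positive, so both summands of
    [m] are below [m], and all terms below [m] lie in the prefix that [m] extends. *)
Lemma ulam_unique_rep m : ulam a b m ->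
  [\/ m = a, m = b | maxn a b < m /\
    exists x y, [/\ ulam a b x, ulam a b y, x < y, x + y = m
      & forall u v, ulam a b u -> ulam a b v -> u < v -> u + v = m -> u = x]].
Proof.
case; elim=> [|n IHn].
  by rewrite mem_ulam_prefix0 => /orP[/eqP|/eqP]; [apply: Or31 | apply: Or32].
rewrite mem_ulam_prefixS => /orP[/eqP em|/IHn //]; apply: Or33.
have [/andP[/allP lt_next /eqP]] := ulam_prefix_nextP n.
rewrite -em => /(nreps_eq1P _ (ulam_prefix_uniq n)).
move=> [x [y [xs ys ltxy exy uxy]]] _; split.
  have an : a \in ulam_prefix a b n.
    by rewrite -[n]addn0 sub_ulam_prefix // mem_ulam_prefix0 eqxx.
  have bn : b \in ulam_prefix a b n.
    by rewrite -[n]addn0 sub_ulam_prefix // mem_ulam_prefix0 eqxx orbT.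
  by have := (lt_next a an, lt_next b bn); rewrite -em => -[] /=; lia.
exists x, y; split=> //; [by exists n | by exists n |].
move=> u v uu uv ltuv euv; have u0 := ulam_gt0 uu.
apply: (uxy u v) => //; apply: ulam_prefix_next_initial => //; lia.
Qed.

(** In the first prefix with an element [z >= m], this [z] is the newly appended least candidate. As
    [m] is a candidate at that stage too, [z = m]. *)
Lemma ulam_intro m x y : maxn a b < m -> ulam a b x -> ulam a b y ->
  x != y -> x + y = m ->
  (forall u v, ulam a b u -> ulam a b v -> u < v -> u + v = m -> u = x \/ u = y) ->
  ulam a b m.
Proof.
wlog ltxy : x y / x < y => [wl ltm ux uy nxy exy uxy|].
  have [ltxy|leyx] := ltnP x y; first exact: (wl x y).
  apply: (wl y x) => //; try lia.
  by move=> u v uu uv ltuv euv; have := uxy u v uu uv ltuv euv; tauto.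
move=> ltm ux uy _ exy uxy.
have big : exists n, has (leq m) (ulam_prefix a b n).
  (* The prefix of index [m] has [m + 2] distinct terms, too many to lie all below [m]. *)
  exists m; apply/negPn/negP => /hasPn small.
  have [_ _ sz] := ulam_prefixP m a0 b0 nab.
  have : size (ulam_prefix a b m) <= size (iota 0 m).
    apply: uniq_leq_size (ulam_prefix_uniq m) _ => z /small.
    by rewrite mem_iota; lia.
  by rewrite sz size_iota; lia.
case: (ex_minnP big) => -[/hasP[z]|n /hasP[z]].
  by rewrite mem_ulam_prefix0; lia.
rewrite mem_ulam_prefixS => zn lemz min_n.
have small w : w \in ulam_prefix a b n -> w < m.
  move=> wn; rewrite ltnNge; apply/negP => lemw.
  have /min_n : has (leq m) (ulam_prefix a b n) by apply/hasP; exists w.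
  by rewrite ltnn.
have {zn} ez : z = ulam_next (ulam_prefix a b n).
  by case/orP: zn => [/eqP //|/small]; rewrite ltnNge lemz.
have below w : ulam a b w -> w < m -> w \in ulam_prefix a b n.
  by move=> uw ltw; apply: ulam_prefix_next_initial => //; rewrite -ez; lia.
have [x0 y0] := (ulam_gt0 ux, ulam_gt0 uy).
have cand : ulam_candidate (ulam_prefix a b n) m.
  apply/andP; split; first exact/allP.
  apply/eqP/(nreps_eq1P _ (ulam_prefix_uniq n)).
  exists x, y; split=> //; try by apply: below => //; lia.
  move=> u v un vn ltuv euv.
  have [] := uxy u v _ _ ltuv euv; [by exists n | by exists n | by [] | lia].
have [_ /(_ m cand)] := ulam_prefix_nextP n; rewrite -ez => lezm.
exists n.+1; rewrite mem_ulam_prefixS -ez; lia.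
Qed.

(** The equal sums and [x < u < v] force [v < y], so both pairs are in increasing order and
    uniqueness would give [x = u]. *)
Lemma ulam_not_two_reps x y u v :
  maxn a b < x + y -> ulam a b x -> ulam a b y -> ulam a b u -> ulam a b v ->
  x < u -> u < v -> x + y = u + v -> ~ ulam a b (x + y).
Proof.
move=> ltm ux uy uu uv ltxu ltuv e /ulam_unique_rep[ea|eb|[_]]; [lia|lia|].
case=> p [q [_ _ _ _ uniq_pq]].
have exp : x = p by apply: (uniq_pq x y) => //; lia.
have eup : u = p by apply: (uniq_pq u v) => //; lia.
lia.
Qed.

Lemma ulam_comb m : ulam a b m -> exists p q, m = p * a + q * b.
Proof.
elim/ltn_ind: m => m IHm /ulam_unique_rep[->|->|[_]].
- by exists 1, 0; lia.
- by exists 0, 1; lia.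
case=> x [y [ux uy ltxy exy _]]; have x0 := ulam_gt0 ux.
have [|p [q ex]] := IHm x _ ux; first lia.
have [|r [s ey]] := IHm y _ uy; first lia.
by exists (p + r), (q + s); lia.
Qed.

Lemma ulam_ge_minn m : ulam a b m -> minn a b <= m.
Proof. by case/ulam_unique_rep => [||[]]; lia. Qed.

(** The smaller summand is at least [minn a b], so the larger is at most [maxn a b]; only the two
    generators remain. *)
Lemma ulam_addn : ulam a b (a + b).
Proof.
apply: (ulam_intro _ (ulam_l a b) (ulam_r a b)) => //; first lia.
move=> u v uu uv ltuv euv; have := ulam_ge_minn uu.
by case: (ulam_unique_rep uv) => [||[]]; lia.
Qed.

End Terms.

(** * Coprime combinations and multiples of a generator *)

Lemma comb_eq_multiple (a b i p q : nat) : 0 < a -> 0 < b -> coprime a b -> i <= b ->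
  p * a + q * b = i * a -> (p = i /\ q = 0) \/ [/\ p = 0, q = a & i = b].
Proof.
move=> a0 b0 co leib e.
have /dvdnP[t et] : a %| q.
  rewrite -(Gauss_dvdl q co) -(dvdn_addr _ (dvdn_mull p (dvdnn a))).
  by rewrite e dvdn_mull.
subst q; have {}e : p + t * b = i.
  by apply/eqP; rewrite -(eqn_pmul2r a0) mulnDl -e; apply/eqP; lia.
(* From [p + t * b = i <= b], the value [t = 1] forces [p = 0] and [i = b], and [t >= 2] is
   contradictory. *)
by case: t e => [|[|t]] e; [left; lia | right; split; lia | left; nia].
Qed.

Lemma comb_eq_addn (a b j p q : nat) : 0 < a -> 1 < b -> coprime a b -> j <= a ->
  p * a + q * b = a + j * b -> (p = 1 /\ q = j) \/ (p = b.+1 /\ q = 0).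
Proof.
move=> a0 b1 co leja e; case: p e => [|p] e.
  have : b %| a.
    by rewrite -(dvdn_addl _ (dvdn_mull j (dvdnn b))) -e dvdn_mull.
  by move/gcdn_idPr; rewrite (eqP co); lia.
have := @comb_eq_multiple b a j q p; rewrite coprime_sym => /(_ (ltnW b1) a0 co leja).
by case=> [|[-> ->]|[-> -> _]]; lia.
Qed.

(** Below index [b], the summands of a multiple of [a] are themselves multiples of [a]; by strong
    induction both equal [a], against distinctness. *)
Lemma ulam_multiple_lt (a b i : nat) : 0 < a -> 0 < b -> a != b -> coprime a b ->
  i < b -> ulam a b (i * a) -> i = 1.
Proof.
move=> a0 b0 nab co; elim/ltn_ind: i => i IHi ltib uia.
case: (ulam_unique_rep a0 b0 nab uia) => [ea|eb|[_]].
- by nia.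
(* Here coprimality gives [a = 1], so [i = b], against [i < b]. *)
- have : a %| b by rewrite -eb dvdn_mull.
  by move=> dab; move: co; rewrite /coprime (gcdn_idPl dab) => /eqP; nia.
case=> x [y [ux uy ltxy exy _]].
have [p [q ex]] := ulam_comb a0 b0 nab ux.
have [r [s ey]] := ulam_comb a0 b0 nab uy.
have [x0 y0] := (ulam_gt0 a0 b0 nab ux, ulam_gt0 a0 b0 nab uy).
have [|[epr eqs]|[_ _]] := @comb_eq_multiple a b i (p + r) (q + s) a0 b0 co (ltnW ltib).
- by lia.
- have [eq0 es0] : q = 0 /\ s = 0 by lia.
  have ep : p = 1 by apply: IHi; [nia|lia|move: ux; rewrite ex eq0 addn0].
  have er : r = 1 by apply: IHi; [nia|lia|move: uy; rewrite ey es0 addn0].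
  by nia.
by lia.
Qed.

(** At index [b] the product may also split into multiples of [b]; in either splitting both summands
    would be the same generator. *)
Lemma not_ulam_mul (a b : nat) : 1 < a -> 1 < b -> a != b -> coprime a b ->
  ~ ulam a b (b * a).
Proof.
move=> a1 b1 nab co uba.
have [a0 b0] : 0 < a /\ 0 < b by lia.
case: (ulam_unique_rep a0 b0 nab uba) => [||[_]]; [nia|nia|].
case=> x [y [ux uy ltxy exy _]].
have [p [q ex]] := ulam_comb a0 b0 nab ux.
have [r [s ey]] := ulam_comb a0 b0 nab uy.
have [x0 y0] := (ulam_gt0 a0 b0 nab ux, ulam_gt0 a0 b0 nab uy).
have [|[epr eqs]|[epr eqs _]] := @comb_eq_multiple a b b (p + r) (q + s) a0 b0 co (leqnn b).
- by lia.
- have [eq0 es0] : q = 0 /\ s = 0 by lia.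
  rewrite eq0 mul0n addn0 in ex; rewrite es0 mul0n addn0 in ey.
  have ep : p = 1 by apply: (@ulam_multiple_lt a b) => //; [nia | rewrite -ex].
  have er : r = 1 by apply: (@ulam_multiple_lt a b) => //; [nia | rewrite -ey].
  by nia.
have [ep0 er0] : p = 0 /\ r = 0 by lia.
rewrite ep0 mul0n add0n in ex; rewrite er0 mul0n add0n in ey.
have mulb k : k < a -> ulam a b (k * b) -> k = 1.
  by move=> ltka /ulamC ukb; apply: (@ulam_multiple_lt b a); rewrite 1?eq_sym 1?coprime_sym.
have eq1 : q = 1 by apply: mulb; [nia | rewrite -ex].
have es1 : s = 1 by apply: mulb; [nia | rewrite -ey].
by nia.
Qed.

Lemma ulam_multiple_le (a b i : nat) : 1 < a -> 1 < b -> a != b -> coprime a b ->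
  i <= b -> ulam a b (i * a) -> i = 1.
Proof.
move=> a1 b1 nab co; rewrite leq_eqVlt => /orP[/eqP->|ltib].
  by move=> uba; case: (not_ulam_mul a1 b1 nab co uba).
by apply: ulam_multiple_lt => //; apply: ltnW.
Qed.

(** * The term [(b + 1) * a] *)

Lemma ulam_line (a b j : nat) : 1 < a -> 1 < b -> a != b -> coprime a b ->
  j <= a -> ulam a b (a + j * b).
Proof.
move=> a1 b1 nab co; have [a0 b0] : 0 < a /\ 0 < b by lia.
elim: j => [|j IHj] leja; first by rewrite addn0; exact: ulam_l.
have {}IHj : ulam a b (a + j * b) by apply: IHj; lia.
apply: (ulam_intro a0 b0 nab _ (ulam_r a b) IHj); first nia.
- by apply/eqP; case: j leja IHj => [|j] *; [move/eqP: nab | ]; nia.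
- by lia.
have mulb k : k <= a -> ulam a b (k * b) -> k = 1.
  by move=> leka /ulamC ukb; apply: (@ulam_multiple_le b a); rewrite 1?eq_sym 1?coprime_sym.
move=> u v uu uv ltuv euv.
have [p [q eu]] := ulam_comb a0 b0 nab uu.
have [r [s ev]] := ulam_comb a0 b0 nab uv.
have [u0 v0] := (ulam_gt0 a0 b0 nab uu, ulam_gt0 a0 b0 nab uv).
have [|[epr eqs]|[epr eqs]] := @comb_eq_addn a b j.+1 (p + r) (q + s) a0 b1 co leja.
- by lia.
(* As [p + r = 1], one summand is a multiple of [b] of index at most [a], hence [b] itself. *)
- have [ep0|er0] : p = 0 \/ r = 0 by lia.
    have eq1 : q = 1 by apply: mulb; [lia | move: uu; rewrite eu ep0].
    by left; lia.
  have es1 : s = 1 by apply: mulb; [lia | move: uv; rewrite ev er0].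
  by right; lia.
(* Now [p + r = b + 1] with both positive, so both indices are at most [b], hence equal to 1, and
   [u = v]. *)
have [eq0 es0] : q = 0 /\ s = 0 by lia.
rewrite eq0 mul0n addn0 in eu; rewrite es0 mul0n addn0 in ev.
have ep : p = 1 by apply: (@ulam_multiple_le a b) => //; [nia | rewrite -eu].
have er : r = 1 by apply: (@ulam_multiple_le a b) => //; [nia | rewrite -ev].
by lia.
Qed.

(** Two distinct terms other than 1 sum to more than [2 * b], so up to that bound every
    representation uses 1. The value [j = b] settles the case of a generator equal to 1 below. *)
Lemma ulam_1_addn (b j : nat) : 1 < b -> j <= b -> ulam 1 b (b + j).
Proof.
move=> b1; have nb1 : 1 != b by lia.
have b0 : 0 < b by lia.
elim: j => [|j IHj] lejb; first by rewrite addn0; exact: ulam_r.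
have {}IHj : ulam 1 b (b + j) by apply: IHj; lia.
apply: (ulam_intro (ltn0Sn 0) b0 nb1 _ (ulam_l 1 b) IHj); try lia.
by move=> u v uu uv ltuv euv; case: (ulam_unique_rep (ltn0Sn 0) b0 nb1 uu) => [||[]]; lia.
Qed.

Lemma ulam_succ_mul (a b : nat) : 0 < a -> 0 < b -> a != b -> coprime a b ->
  ulam a b ((b + 1) * a).
Proof.
move=> a0 b0 nab co.
have [a1|a1] : a = 1 \/ 1 < a by lia.
  have -> : (b + 1) * a = a + b by lia.
  exact: ulam_addn.
have [b1|b1] : b = 1 \/ 1 < b by lia.
  rewrite b1; have -> : (1 + 1) * a = a + a by lia.
  exact/ulamC/ulam_1_addn.
have -> : (b + 1) * a = a + a * b by lia.
exact: ulam_line.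
Qed.

(** * Progressions and their forbidden next element *)

Lemma not_ulam_progression (a b c : nat) : 0 < a -> 0 < b -> a != b -> coprime a b ->
  (b + 1) * a < c -> ulam a b c -> ulam a b (c + b * a) ->
  ~ ulam a b (c + (b + 1) * a).
Proof.
move=> a0 b0 nab co ltc uc uca.
have -> : c + (b + 1) * a = a + (c + b * a) by lia.
(* The bound on [c] gives [a < (b + 1) * a < c], which makes the two representations genuinely
   different. *)
apply: (ulam_not_two_reps a0 b0 nab _ (ulam_l a b) uca
  (ulam_succ_mul a0 b0 nab co) uc); nia.
Qed.

Theorem theorem1p7 (a b : nat) (ha : 0 < a) (hb : 0 < b) (hab : a != b)
    (hco : coprime a b) :
  (forall c : nat, (b + 1) * a < c ->
     (forall i : nat, i <= b -> ulam a b (c + i * a)) ->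
     ~ ulam a b (c + (b + 1) * a))
  /\
  (forall c : nat, b * (a + 1) < c ->
     (forall i : nat, i <= a -> ulam a b (c + i * b)) ->
     ~ ulam a b (c + (a + 1) * b)).
Proof.
split=> c ltc uc.
  apply: not_ulam_progression => //; last exact: uc.
  by have := uc 0 (leq0n _); rewrite addn0.
move/ulamC; apply: not_ulam_progression; rewrite 1?eq_sym 1?coprime_sym //.
- by rewrite mulnC.
- by apply: ulamC; have := uc 0 (leq0n _); rewrite addn0.
- exact/ulamC/uc.
Qed.
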